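(* Let $I\subset\mathbb{R}$ be a nondegenerate interval, let $n\in\mathbb{N}$ with $n\ge2$, and let $\omega:I\to\mathbb{R}^n$ be an $n$-dimensional positive Chebyshev system over $I$. Let $(t_1,\dots,t_n)\in\mathbb{R}_+^n$ and $f:I\to\mathbb{R}$. If, for all $(k,i)\in\{1,\dots,n-1\}^2$, the function $f$ is $\big((t_i\mathbf{1}_k,t_{i+1}\mathbf{1}_{n-k}),\omega\big)$-convex on $I$, then $f$ is $\big((t_1,\dots,t_n),\omega\big)$-convex on $I$.
   Context: $\mathbb{R}_+$ is the set of positive reals. $\sigma_k(I):=\{(x_1,\dots,x_k)\in I^k\mid x_1<\dots<x_k\}$. For $\omega=(\omega_1,\dots,\omega_k):I\to\mathbb{R}^k$ and $(x_1,\dots,x_k)\in\sigma_k(I)$, $\Phi_\omega(x_1,\dots,x_k):=\det\big(\omega_i(x_j)\big)_{i,j=1}^k$. $\omega$ is a $k$-dimensional positive Chebyshev system over $I$ if $\Phi_\omega>0$ on $\sigma_k(I)$. For an $n$-dimensional $\omega$ and $f:I\to\mathbb{R}$, $(\omega,f):=(\omega_1,\dots,\omega_n,f)$. For $t=(t_1,\dots,t_n)\in\mathbb{R}_+^n$, $f:I\to\mathbb{R}$ is $(t,\omega)$-convex on $I$ if $$\Phi_{(\omega,f)}\big(x,x+t_1h,x+(t_1+t_2)h,\dots,x+(t_1+\dots+t_n)h\big)\ge0$$ for all $h>0$ and $x\in I$ with $x+(t_1+\dots+t_n)h\in I$. $(u\mathbf{1}_k,v\mathbf{1}_m)$ denotes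 the vector in $\mathbb{R}^{k+m}$ whose first $k$ coordinates equal $u$ and whose last $m$ coordinates equal $v$. *)

(* Defs.v *)
From HB Require Import structures.
From mathcomp Require Import all_boot all_order all_algebra.
From mathcomp Require Import all_classical all_reals topology normedtype.

Set Implicit Arguments.
Unset Strict Implicit.
Unset Printing Implicit Defensive.

Import Order.TTheory GRing.Theory Num.Theory.

Local Open Scope classical_set_scope.
Local Open Scope ring_scope.

(* Maps I -> T are represented by total maps R -> T; every definition below only
   evaluates them at points of I. Vectors of R^k are row vectors, so the
   coordinate indices are shifted from {1,...,k} to {0,...,k-1}. *)

Definition nondegenerate_interval (R : realType) (I : set R) : Prop :=
  is_interval I /\ exists x y : R, [/\ I x, I y & x < y].

Definition sigma (R : realType) (I : set R) (k : nat) : set 'rV[R]_k :=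
  [set x | (forall i : 'I_k, I (x 0 i)) /\
           (forall i j : 'I_k, (i < j)%N -> x 0 i < x 0 j)].

Definition Phi (R : realType) (k : nat) (w : R -> 'rV[R]_k) (x : 'rV[R]_k) : R :=
  \det (\matrix_(i < k, j < k) w (x 0 j) 0 i).

Definition positive_chebyshev (R : realType) (I : set R) (k : nat)
    (w : R -> 'rV[R]_k) : Prop :=
  forall x : 'rV[R]_k, sigma I x -> 0 < Phi w x.

Definition adjoin (R : realType) (n : nat) (w : R -> 'rV[R]_n) (f : R -> R) :
    R -> 'rV[R]_(n + 1) :=
  fun x => row_mx (w x) (const_mx (f x)).

(* (x, x + t_1 h, x + (t_1 + t_2) h, ..., x + (t_1 + ... + t_n) h) *)
Definition nodes (R : realType) (n : nat) (t : 'rV[R]_n) (x h : R) :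
    'rV[R]_(n + 1) :=
  \row_(j < n + 1) (x + (\sum_(i < n | (i < j)%N) t 0 i) * h).

Definition tconvex (R : realType) (I : set R) (n : nat) (t : 'rV[R]_n)
    (w : R -> 'rV[R]_n) (f : R -> R) : Prop :=
  forall h x : R, 0 < h -> I x -> I (x + (\sum_(i < n) t 0 i) * h) ->
    0 <= Phi (adjoin w f) (nodes t x h).

(* For k <= n this is (u 1_k, v 1_(n-k)); a case distinction on the index avoids
   casting along k + (n - k) = n. *)
Definition two_block (R : realType) (n k : nat) (u v : R) : 'rV[R]_n :=
  \row_(j < n) (if (j < k)%N then u else v).

(* Main.v *)
Require Import Defs.
From HB Require Import structures.
From mathcomp Require Import all_boot all_order all_algebra.
From mathcomp Require Import all_classical all_reals topology normedtype.
From mathcomp Require Import zify ring.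

Import Order.TTheory GRing.Theory Num.Theory.

Local Open Scope classical_set_scope.
Local Open Scope ring_scope.

(** Divide each interval between consecutive nodes [x + (t_1 + ... + t_(i-1)) h]
    and [x + (t_1 + ... + t_i) h] into [n - 1] equal parts. Any [n] consecutive
    steps of the refined grid meet exactly two of the original intervals, so they
    have the form [(t_i 1_k, t_(i+1) 1_(n-k)) h / (n - 1)] with [1 <= k <= n - 1],
    and the hypothesis applies to them. Nonnegativity on consecutive grid points
    propagates to all increasing tuples of grid points: deleting an interior point
    from [n + 2] points gives a determinant which is a positive combination of
    those obtained by deleting the first and the last point. *)

(** With functions and points indexed by [nat], deleting the point [j] is composition with [bump j]
    and dropping the first point is composition with [succn], without casts between ordinals. *)
Definition altdet {R : comNzRingType} {T : Type} (W : nat -> T -> R) (k : nat)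
    (p : nat -> T) : R :=
  \det (\matrix_(i < k, j < k) W i (p j)).

Lemma eq_altdet {R : comNzRingType} {T : Type} (W : nat -> T -> R) (k : nat)
    (p q : nat -> T) :
  (forall i, (i < k)%N -> p i = q i) -> altdet W k p = altdet W k q.
Proof.
by move=> pq; congr (\det _); apply/matrixP => i j; rewrite !mxE pq.
Qed.

Lemma cofactor_altdet {R : comNzRingType} {T : Type} (W : nat -> T -> R) (n : nat)
    (p : nat -> T) (j : 'I_n.+1) :
  cofactor (\matrix_(i < n.+1, j < n.+1) W i (p j)) ord_max j =
  (-1) ^+ (n + j) * altdet W n (p \o bump j).
Proof.
rewrite /cofactor; congr (_ * \det _).
by apply/matrixP => i k; rewrite !mxE lift_max.
Qed.

(* The sums [\sum_j W i (p j) * cofactor], [i < n], vanish, so the last function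
   may be modified by a combination of the others before expanding. *)
Lemma altdet_expand {R : comNzRingType} {T : Type} (W : nat -> T -> R) (n : nat)
    (c : 'I_n -> R) (p : nat -> T) :
  altdet W n.+1 p =
  \sum_(j < n.+1) (W n (p j) - \sum_(i < n) c i * W i (p j)) *
                  ((-1) ^+ (n + j) * altdet W n (p \o bump j)).
Proof.
set A := \matrix_(i < n.+1, j < n.+1) W i (p j).
have row_cofactor (i : 'I_n.+1) :
    \sum_(j < n.+1) W i (p j) * cofactor A ord_max j = (\det A) *+ (i == ord_max).
  have /matrixP/(_ i ord_max) := mul_mx_adj A.
  by rewrite !mxE => <-; apply: eq_bigr => j _; rewrite !mxE.
under eq_bigr => j _ do rewrite -cofactor_altdet -/A mulrBl mulr_suml.
rewrite sumrB exchange_big /= (row_cofactor ord_max) eqxx mulr1n big1 ?subr0 //.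
move=> i _; under eq_bigr => j _ do rewrite -mulrA.
have := row_cofactor (widen_ord (leqnSn n) i).
rewrite -val_eqE /= ltn_eqF // mulr0n => r0.
by rewrite -mulr_sumr r0 mulr0.
Qed.

Lemma altdet_interpolation {F : fieldType} {T : Type} (W : nat -> T -> F) (n : nat)
    (p : nat -> T) :
  altdet W n p != 0 ->
  exists c : 'I_n -> F,
    forall j, (j < n)%N -> W n (p j) = \sum_(i < n) c i * W i (p j).
Proof.
set A := \matrix_(i < n, j < n) W i (p j) => detA.
pose v := \row_(j < n) W n (p j).
exists (fun i => (v *m invmx A) 0 i) => j jn.
have Au : A \in unitmx by rewrite unitmxE unitfE.
have /matrixP/(_ 0 (Ordinal jn)) := mulmxKV Au v.
by rewrite !mxE => <-; apply: eq_bigr => i _; rewrite !mxE.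
Qed.

(* After subtracting the interpolant at [p 1, ..., p n], only the values at [p 0]
   and [p n.+1] remain, and the two hypotheses on [altdet W n.+1] give their signs. *)
Lemma altdet_skip_ge0 {F : realFieldType} {T : Type} (W : nat -> T -> F) (n : nat)
    (p : nat -> T) (j : nat) :
  (0 < j <= n)%N ->
  0 < altdet W n (p \o succn) ->
  0 < altdet W n (p \o bump j \o succn) ->
  0 < altdet W n (p \o bump j) ->
  0 <= altdet W n.+1 p -> 0 <= altdet W n.+1 (p \o succn) ->
  0 <= altdet W n.+1 (p \o bump j).
Proof.
move=> /andP[j0 jn] mid_gt0 right_gt0 left_gt0.
have [c cP] := altdet_interpolation W n (p \o succn) (lt0r_neq0 mid_gt0).
pose g x := W n x - \sum_(i < n) c i * W i x.
have g0 i : (0 < i <= n)%N -> g (p i) = 0.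
  by case: i => // i /andP[_ ilt]; rewrite /g -(cP i) ?subrr.
have expand q : altdet W n.+1 q =
    \sum_(i < n.+1) g (q i) * ((-1) ^+ (n + i) * altdet W n (q \o bump i)).
  exact: altdet_expand.
rewrite !expand.
rewrite (bigD1 ord0) //= big1 ?addr0; last first.
  by move=> i i0; rewrite g0 ?mul0r // lt0n -ltnS ltn_ord andbT.
rewrite (bigD1 ord_max) //= big1 ?addr0; last first.
  move=> i i0; rewrite g0 ?mul0r //=.
  by rewrite ltn_neqAle i0 -ltnS ltn_ord.
rewrite addn0 addnn -mul2n exprM sqrrN expr1n expr1n mul1r mulrA => gl gr.
(* The sign of [g (p 0)] is known only up to [(-1) ^+ n], the factor that its term carries again in
   the target expansion. *)
have {}gl : 0 <= g (p 0%N) * (-1) ^+ n.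
  have e : altdet W n (p \o bump 0) = altdet W n (p \o succn) by apply: eq_altdet.
  by move: gl; rewrite e pmulr_lge0.
have {}gr : 0 <= g (p n.+1).
  have e : altdet W n (p \o succn \o bump n) = altdet W n (p \o succn).
    by apply: eq_altdet => i ilt; rewrite /= /bump leqNgt ilt.
  by move: gr; rewrite e pmulr_lge0.
(* As [0 < j <= n], deleting [p j] keeps both end points: they are the terms [i = 0] and [i = n],
   and all other terms vanish. *)
apply: sumr_ge0 => i _ /=.
have [i0|i_gt0] := posnP (i : nat).
  have e : altdet W n (p \o bump j \o bump i) = altdet W n (p \o bump j \o succn).
    by apply: eq_altdet => k _; rewrite i0.
  by rewrite e i0 addn0 /bump leqNgt j0 add0n mulrA mulr_ge0 // ltW.
have [i_n|i_n] := eqVneq (i : nat) n.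
  have e : altdet W n (p \o bump j \o bump i) = altdet W n (p \o bump j).
    by apply: eq_altdet => k kn; rewrite /= i_n (_ : bump n k = k) // /bump leqNgt kn.
  rewrite e i_n addnn -mul2n exprM sqrrN !expr1n mul1r /bump jn add1n.
  by rewrite mulr_ge0 // ltW.
by rewrite g0 ?mul0r // /bump; have := ltn_ord i; lia.
Qed.

(** Induction on the span [e n - e 0]: a skipped index can be inserted, and dropping either end of
    the enlarged tuple leaves a smaller span. Without skipped indices the tuple is consecutive. *)
Lemma altdet_grid_ge0 {F : realFieldType} {T : Type} (W : nat -> T -> F) (n N : nat)
    (y : nat -> T) :
  (forall e : nat -> nat,
     (forall i j, (i < j < n)%N -> (e i < e j)%N) ->
     (forall i, (i < n)%N -> (e i <= N)%N) -> 0 < altdet W n (y \o e)) ->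
  (forall s, (s + n <= N)%N -> 0 <= altdet W n.+1 (y \o addn s)) ->
  forall e : nat -> nat,
    (forall i j, (i < j <= n)%N -> (e i < e j)%N) -> (e n <= N)%N ->
    0 <= altdet W n.+1 (y \o e).
Proof.
move=> low_gt0 consecutive e.
have [d] := ubnP (e n - e 0)%N; elim: d e => // d IHd e span_e e_incr e_N.
have [[j jn gap]|no_gap] := pselect (exists2 j, (j < n)%N & ((e j).+1 < e j.+1)%N).
  (* [e'] inserts [(e j).+1] into the gap after [e j], so [e] is [e'] with its entry [j.+1]
     deleted. *)
  pose e' i := if (i <= j)%N then e i else if i == j.+1 then (e j).+1 else e i.-1.
  have e'K i : e' (bump j.+1 i) = e i.
    rewrite /e' /bump; case: ltnP => ij; last by rewrite add0n ij.
    by rewrite add1n ifF ?ifF //=; lia.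
  have e_mono i k : (i <= k <= n)%N -> (e i <= e k)%N.
    case/andP; rewrite leq_eqVlt => /orP[/eqP->//|ik kn].
    by rewrite ltnW // e_incr // ik.
  have e'_incr i k : (i < k <= n.+1)%N -> (e' i < e' k)%N.
    move=> /andP[ik kn]; rewrite /e'.
    have [kj|jk] := leqP k j.
      have -> : (i <= j)%N by lia.
      by apply: e_incr; lia.
    have [ij|ji] := leqP i j.
      have [kj|kj] := eqVneq k j.+1; first by rewrite ltnS e_mono //; lia.
      by apply: e_incr; lia.
    have -> : (k == j.+1) = false by lia.
    have [ij|ij] := eqVneq i j.+1.
      by apply: (leq_trans gap); apply: e_mono; lia.
    by apply: e_incr; lia.
  have e'n : e' n.+1 = e n by rewrite /e' ltnNge (ltnW jn) /= eqSS gtn_eqF.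
  have e'_N i : (i <= n.+1)%N -> (e' i <= N)%N.
    rewrite leq_eqVlt => /orP[/eqP->|ilt]; first by rewrite e'n.
    by apply: leq_trans e_N; rewrite -e'n ltnW // e'_incr // ilt leqnn.
  have eE : altdet W n.+1 (y \o e) = altdet W n.+1 (y \o e' \o bump j.+1).
    by apply: eq_altdet => i _ /=; rewrite e'K.
  have e'0 : e' 0%N = e 0%N by [].
  have e'01 : (e' 0 < e' 1)%N by apply: e'_incr.
  have e'1n : (e' 1 <= e' n.+1)%N by apply/ltnW/e'_incr; lia.
  have e'nn : (e' n < e' n.+1)%N by apply: e'_incr; rewrite ltnSn.
  have low g : (forall i k, (i < k < n)%N -> (g i < g k <= n.+1)%N) ->
      (forall i, (i < n)%N -> (g i <= n.+1)%N) -> 0 < altdet W n (y \o e' \o g).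
    move=> g_incr g_N; apply: (low_gt0 (e' \o g)) => [i k ik|i ilt] /=.
      by apply: e'_incr; apply: g_incr.
    exact/e'_N/g_N.
  rewrite eE; apply: altdet_skip_ge0.
  - by rewrite ltnS leq0n jn.
  - by apply: low => [i k|i]; lia.
  - by apply: (low (bump j.+1 \o succn)) => [i k|i]; rewrite /= /bump; lia.
  - by apply: low => [i k|i]; rewrite /bump; lia.
  - apply: IHd => [|i k ik|]; [lia| |exact: e'_N].
    by apply: e'_incr; lia.
  - apply: (IHd (e' \o succn)) => [|i k ik|] /=; [lia| |exact: e'_N].
    by apply: e'_incr; lia.
have eE i : (i <= n)%N -> e i = (e 0 + i)%N.
  elim: i => [|i IHi] ilt; first by rewrite addn0.
  have : ~ ((e i).+1 < e i.+1)%N by move=> gap; apply: no_gap; exists i.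
  have : (e i < e i.+1)%N by apply: e_incr; rewrite ltnSn.
  by move: (IHi (ltnW ilt)); lia.
rewrite (eq_altdet _ _ _ (y \o addn (e 0%N))); last first.
  by move=> i ilt /=; rewrite eE.
by apply: consecutive; rewrite -eE.
Qed.

(* [f] is stored in the junk values at [i >= n]; only index [n] is used. This avoids
   casts between ['I_(n + 1)] and ['I_n.+1]. *)
Definition adjoin_coord {R : realType} {n : nat} (w : R -> 'rV[R]_n) (f : R -> R)
    (i : nat) (x : R) : R :=
  if insub i is Some k then w x 0 k else f x.

Lemma Phi_altdet {R : realType} {n : nat} (w : R -> 'rV[R]_n) (f : R -> R)
    (p : nat -> R) :
  Phi w (\row_(j < n) p j) = altdet (adjoin_coord w f) n p.
Proof.
congr (\det _); apply/matrixP => i j.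
by rewrite !mxE /adjoin_coord valK.
Qed.

Lemma Phi_adjoin_altdet {R : realType} {n : nat} (w : R -> 'rV[R]_n) (f : R -> R)
    (p : nat -> R) :
  Phi (adjoin w f) (\row_(j < n + 1) p j) = altdet (adjoin_coord w f) n.+1 p.
Proof.
have -> : altdet (adjoin_coord w f) n.+1 p = altdet (adjoin_coord w f) (n + 1) p.
  by rewrite addn1.
congr (\det _); apply/matrixP => i j.
rewrite !mxE /adjoin_coord; case: splitP => k ik.
  by rewrite ik valK.
by rewrite insubF ?mxE // ik ltnNge leq_addr.
Qed.

Theorem theorem7 (R : realType) (I : set R) (hI : nondegenerate_interval I)
    (n : nat) (hn : (2 <= n)%N)
    (w : R -> 'rV[R]_n) (hw : positive_chebyshev I w)
    (t : 'rV[R]_n) (ht : forall i : 'I_n, 0 < t 0 i)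
    (f : R -> R)
    (hf : forall (k : nat) (i j : 'I_n),
        (1 <= k <= n - 1)%N -> j = i.+1 :> nat ->
        tconvex I (two_block n k (t 0 i) (t 0 j)) w f) :
  tconvex I t w f.
Proof.
move=> h x h0 Ix Iend.
case: hI => itvI _.
pose m := n.-1; have m0 : (0 < m)%N by rewrite /m; lia.
have mR0 : m%:R != 0 :> R by rewrite pnatr_eq0 -lt0n.
(* The default value 1 keeps [tau] positive at every index, so [y] increases on all of [nat]. *)
pose tau i : R := if insub i is Some k then t 0 k else 1.
have tauE (i : 'I_n) : tau i = t 0 i by rewrite /tau valK.
have tau0 i : 0 < tau i by rewrite /tau; case: insubP.
have hm0 : 0 < h / m%:R by rewrite divr_gt0 // ltr0n.
(* Step [r] of the refined grid lies in the original interval [r %/ m]; the original nodes are the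
   points [y (j * m)]. *)
pose y s := x + (\sum_(0 <= r < s) tau (r %/ m)%N) * (h / m%:R).
have yD s j : y (s + j)%N =
    y s + (\sum_(i < j) tau ((s + i) %/ m)%N) * (h / m%:R).
  have <- : \sum_(s <= r < s + j) tau (r %/ m)%N = \sum_(i < j) tau ((s + i) %/ m)%N.
    rewrite -{1}(add0n s) big_addn addKn big_mkord.
    by apply: eq_bigr => i _; rewrite addnC.
  by rewrite /y (big_cat_nat (n := s)) ?leq_addr //= mulrDl addrA.
have y_incr i j : (i < j)%N -> y i < y j.
  move=> ij; rewrite -(subnKC ij) addSnnS yD ltrDl mulr_gt0 //.
  by rewrite big_ord_recl ltr_pwDl // sumr_ge0 // => k _; rewrite ltW.
have y_mul j : y (j * m)%N = x + (\sum_(i < j) tau i) * h.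
  elim: j => [|j IHj]; first by rewrite mul0n /y big_geq // big_ord0 !mul0r.
  rewrite mulSn addnC yD IHj big_ord_recr /= mulrDl addrA; congr (_ + _).
  rewrite (eq_bigr (fun=> tau j)).
    by rewrite sumr_const card_ord -mulr_natl; field.
  by move=> i _; rewrite divnMDl // divn_small ?addn0.
have Iy s : (s <= n * m)%N -> I (y s).
  move=> sN; apply: (itvI _ _ Ix Iend); apply/andP; split.
    have -> : x = y 0%N by rewrite /y big_geq // mul0r addr0.
    by case: s {sN} => // s; rewrite ltW // y_incr.
  have -> : x + (\sum_(i < n) t 0 i) * h = y (n * m)%N.
    by rewrite y_mul; under [in RHS]eq_bigr do rewrite tauE.
  by move: sN; rewrite leq_eqVlt => /orP[/eqP->//|/y_incr/ltW].
have node_sum (u : 'I_n -> R) (j : nat) (T : nat -> R) : (j <= n)%N ->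
    (forall i : 'I_n, u i = T i) -> \sum_(i < n | (i < j)%N) u i = \sum_(i < j) T i.
  move=> jn uT; rewrite (big_ord_widen n T jn).
  by apply: eq_bigr => i _; rewrite uT.
have -> : nodes t x h = \row_(j < n + 1) y (j * m)%N.
  apply/rowP => j; rewrite !mxE y_mul (node_sum _ _ tau) //.
  by have := ltn_ord j; lia.
rewrite (Phi_adjoin_altdet w f (y \o muln^~ m)).
apply: (altdet_grid_ge0 _ _ (n * m)).
- move=> e e_incr e_N; rewrite -Phi_altdet; apply: hw; split.
    by move=> i; rewrite mxE; apply/Iy/e_N.
  by move=> i j ij; rewrite !mxE; apply/y_incr/e_incr; rewrite ij /=.
- move=> s sN; pose q := (s %/ m)%N.
  have sE : s = (q * m + s %% m)%N by apply: divn_eq.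
  have s_mod : (s %% m < m)%N by rewrite ltn_mod.
  (* Since [n = m + 1], [s + n <= n * m] means [s < m * m], whence [q < m]. *)
  have q1n : (q.+1 < n)%N.
    have : (q * m < m * m)%N by rewrite /m in sN sE *; nia.
    by rewrite ltn_mul2r m0 /= /m; lia.
  (* [k] counts the steps from [y s] to the end of interval [q]. The other [n - k = s %% m + 1 <= m]
     steps fit into interval [q.+1]. *)
  pose k := (m - s %% m)%N.
  pose i := Ordinal (ltnW q1n); pose j := Ordinal q1n.
  have kP : (1 <= k <= n - 1)%N by rewrite /k /m; lia.
  have stepE (r : 'I_n) : two_block n k (t 0 i) (t 0 j) 0 r = tau ((s + r) %/ m)%N.
    rewrite mxE -!tauE /= {1}sE; case: ltnP; rewrite /k => rk; congr tau.
      by rewrite -addnA divnMDl // divn_small ?addn0 //; lia.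
    have -> : (q * m + s %% m + r = q.+1 * m + (r - (m - s %% m)))%N.
      by rewrite mulSn; lia.
    rewrite divnMDl // divn_small ?addn0 //.
    by have := ltn_ord r; rewrite /m; lia.
  have nodesE : nodes (two_block n k (t 0 i) (t 0 j)) (y s) (h / m%:R) =
      \row_(l < n + 1) y (s + l)%N.
    apply/rowP => l; rewrite !mxE yD.
    rewrite (node_sum _ _ (fun r => tau ((s + r) %/ m)%N)) //.
    by have := ltn_ord l; lia.
  rewrite -Phi_adjoin_altdet -nodesE; apply: hf => //.
    by apply: Iy; apply: leq_trans sN; rewrite leq_addr.
  have -> : \sum_(r < n) two_block n k (t 0 i) (t 0 j) 0 r =
      \sum_(r < n) tau ((s + r) %/ m)%N by apply: eq_bigr.
  by rewrite -yD; apply: Iy.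
- by move=> i j /andP[ij _]; rewrite ltn_mul2r m0.
- by [].
Qed.
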